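(* Let $S\in\mathcal{S}^d_m$, $G\in\mathcal{M}(S)$, $j\in\{1,\dots,d\}$, and assume that $D:=\operatorname{int}\operatorname{dom}\psi_G\ne\emptyset$. For every $n\ge1$, there exist a compact set $C_n\subset G-G$ with $$x^j>0\quad\text{and}\quad S(x,x)>0,\qquad x\in C_n,$$ and a function $h_n\in\mathcal{H}^j_{\theta^j(C_n)}$ such that $$\Sigma^j_1(P_G)\subset\bigcup_{n}\{x\in\mathbb{R}^d:\ h_n(Sx)=0\}.$$ For any $\epsilon>0$, all $C_n$ can be chosen such that $\operatorname{diam}\theta^j(C_n)<\epsilon$.
   Context: $\mathcal{S}^d_m$ is the set of invertible symmetric real $d\times d$ matrices with exactly $m\in\{0,1,\dots,d\}$ positive eigenvalues. For $S\in\mathcal{S}^d_m$, $S(x,y)=\langle x,Sy\rangle$ for $x,y\in\mathbb{R}^d$. $\mathcal{M}(S)$ is the family of closed non-empty $S$-monotone sets $G\subset\mathbb{R}^d$, i.e. $S(x-y,x-y)\ge0$ for all $x,y\in G$. For such $G$, and $x\in\mathbb{R}^d$, $$\psi_G(x)=\sup_{y\in G}\Big(S(x,y)-\tfrac12S(y,y)\Big)\in\mathbb{R}\cup\{+\infty\},\qquad P_G(x)=\operatorname*{arg\,min}_{y\in G}S(x-y,x-y)$$ (the possibly empty set of minimizers), and $\operatorname{dom}\psi_G=\{x:\psi_G(x)<\infty\}$. $\Sigma^j_1(P_G)$ is the set of $x\in\mathbb{R}^d$ for which there exist $y_1,y_2\in P_G(x)$ with $y_1^j\ne y_2^j$ and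 $S(y_1-y_2,y_1-y_2)>0$. $G-G=\{a-b:a,b\in G\}$; $\operatorname{diam}E=\sup_{x,y\in E}|x-y|$ (Euclidean norm). $x^j$ is the $j$th coordinate of $x\in\mathbb{R}^d$ and $x^{-j}\in\mathbb{R}^{d-1}$ is $x$ with its $j$th coordinate removed. For a compact set $C\subset\{x\in\mathbb{R}^d: x^j>0\}$, $\theta^j(C)=\{y/y^j: y\in C\}$, a compact set all of whose elements have $j$th coordinate $1$. For a compact set $C$ all of whose elements have $j$th coordinate equal to $1$, $\mathcal{H}^j_C$ is the family of functions $h$ on $\mathbb{R}^d$ of the form $$h(x)=x^j+g_1(x^{-j})-g_2(x^{-j}),$$ where $g_1,g_2:\mathbb{R}^{d-1}\to\mathbb{R}$ are convex, have linear growth ($|g_i(u)|\le K(1+|u|)$ for some constant $K>0$ and all $u$), and $\nabla h(x)\in C$ whenever both $g_1$ and $g_2$ are differentiable at $x^{-j}$.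
   Formalization: The sets C_n and functions h_n are asserted only if G−G contains some x with x^j>0 and S(x,x)>0; otherwise (e.g. G a singleton) every C_n is empty, the class H^j of the empty set is empty and the literal claim fails, so Σ^j_1(P_G)=∅ is stated instead. *)

(* Defs.v *)
From HB Require Import structures.
From mathcomp Require Import all_boot all_order all_algebra.
From mathcomp Require Import all_classical all_reals all_analysis.

Set Implicit Arguments.
Unset Strict Implicit.
Unset Printing Implicit Defensive.
Import Order.TTheory GRing.Theory Num.Theory.
Import numFieldNormedType.Exports.

Local Open Scope classical_set_scope.
Local Open Scope ring_scope.

(* Points of R^d are column vectors.  The library's norm on 'cV[R]_d is the sup
   norm, which gives the usual topology and differentiability; the Euclidean
   norm is [enorm]. *)
Section Defs.
Context {R : realType}.

Definition dot d (x y : 'cV[R]_d) : R := \sum_(i < d) x i 0 * y i 0.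

Definition enorm d (x : 'cV[R]_d) : R := Num.sqrt (dot x x).

(* The m positive eigenvalues are counted with multiplicity, as roots of the
   characteristic polynomial, which splits over R because S is symmetric. *)
Definition sym_index d (m : nat) (S : 'M[R]_d) : Prop :=
  [/\ S^T = S, S \in unitmx &
      exists s : seq R, char_poly S = \prod_(a <- s) ('X - a%:P) /\
        count (fun a : R => 0 < a) s = m].

Definition bform d (S : 'M[R]_d) (x y : 'cV[R]_d) : R := dot x (S *m y).

Definition Smonotone d (S : 'M[R]_d) (G : set 'cV[R]_d) : Prop :=
  forall x y, G x -> G y -> 0 <= bform S (x - y) (x - y).

Definition monotone_class d (S : 'M[R]_d) : set (set 'cV[R]_d) :=
  [set G | [/\ closed G, G !=set0 & Smonotone S G]].

Definition psi d (S : 'M[R]_d) (G : set 'cV[R]_d) (x : 'cV[R]_d) : \bar R :=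
  ereal_sup [set (bform S x y - 2^-1 * bform S y y)%:E | y in G].

Definition dom_psi d (S : 'M[R]_d) (G : set 'cV[R]_d) : set 'cV[R]_d :=
  [set x | (psi S G x < +oo)%E].

Definition Sproj d (S : 'M[R]_d) (G : set 'cV[R]_d) (x : 'cV[R]_d) :
    set 'cV[R]_d :=
  [set y | G y /\
     forall z, G z -> bform S (x - y) (x - y) <= bform S (x - z) (x - z)].

Definition Sigma1 d (S : 'M[R]_d) (G : set 'cV[R]_d) (j : 'I_d) :
    set 'cV[R]_d :=
  [set x | exists y1 y2, [/\ Sproj S G x y1, Sproj S G x y2,
     y1 j 0 != y2 j 0 & 0 < bform S (y1 - y2) (y1 - y2)]].

Definition diffset d (G : set 'cV[R]_d) : set 'cV[R]_d :=
  [set a - b | a in G & b in G].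

Definition ediam d (E : set 'cV[R]_d) : \bar R :=
  ereal_sup [set (enorm (x - y))%:E | x in E & y in E].

Definition theta d (j : 'I_d) (C : set 'cV[R]_d) : set 'cV[R]_d :=
  [set (y j 0)^-1 *: y | y in C].

Definition linear_growth k (g : 'cV[R]_k -> R) : Prop :=
  exists K : R, 0 < K /\ forall u, `|g u| <= K * (1 + enorm u).

Definition gradient d (h : 'cV[R]_d -> R) (x : 'cV[R]_d) : 'cV[R]_d :=
  \col_(i < d) 'D_(delta_mx i 0) (h : 'cV[R]_d -> R^o) x.

(* [row' j x : 'cV_d.-1] is x with its j-th coordinate removed. *)
Definition Hclass d (j : 'I_d) (C : set 'cV[R]_d) : set ('cV[R]_d -> R) :=
  [set h | exists g1 g2 : 'cV[R]_d.-1 -> R,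
     [/\ convex_function setT g1 /\ convex_function setT g2,
         linear_growth g1 /\ linear_growth g2,
         forall x : 'cV[R]_d, h x = x j 0 + g1 (row' j x) - g2 (row' j x) &
         forall x : 'cV[R]_d,
           differentiable (g1 : 'cV[R]_d.-1 -> R^o) (row' j x) ->
           differentiable (g2 : 'cV[R]_d.-1 -> R^o) (row' j x) ->
           C (gradient h x)]].

Definition admissible d (S : 'M[R]_d) (G : set 'cV[R]_d) (j : 'I_d) :
    set 'cV[R]_d :=
  [set x | [/\ diffset G x, 0 < x j 0 & 0 < bform S x x]].

Definition Sigma1_cover d (S : 'M[R]_d) (G : set 'cV[R]_d) (j : 'I_d)
    (C : nat -> set 'cV[R]_d) (h : nat -> 'cV[R]_d -> R) : Prop :=
  (forall n, [/\ compact (C n), C n `<=` admissible S G j &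
                 Hclass j (theta j (C n)) (h n)]) /\
  Sigma1 S G j `<=` \bigcup_n [set x | h n (S *m x) = 0].

End Defs.

(* Main.v *)
Require Import Defs.
From HB Require Import structures.
From mathcomp Require Import all_boot all_order all_algebra.
From mathcomp Require Import all_classical all_reals all_analysis.
From mathcomp Require Import ring lra.
Import Order.TTheory GRing.Theory Num.Theory.
Import numFieldNormedType.Exports.

Local Open Scope classical_set_scope.
Local Open Scope ring_scope.

(* Take x with two projections y1, y2 in G, y1^j > y2^j, and compact pieces A, B
   of G around y1 and y2 that are separated in the j-th coordinate by a < b.
   With f_A(z) = sup_{y in A} (<z,y> - S(y,y)/2), and f_B likewise, both suprema
   coincide at z = Sx.  The difference f_A - f_B increases in z^j at rate at
   least b - a, so {f_A = f_B} is the graph z^j = T(z^{-j}).  For c in [a, b],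
   f_A - c z^j increases and f_B - c z^j decreases in z^j, so
     v_c(u) = f_A(T(u), u) - c T(u) = min_t max(f_A(t,u) - c t, f_B(t,u) - c t)
   is convex as a partial minimum of a convex function, and
   T = (v_a - v_b)/(b - a) is a difference of convex functions.  Where v_a and
   v_b are differentiable, the affine pieces of f_A and f_B attained on the
   graph have the same gradient along it; this puts the gradient of z^j - T in
   theta^j(A - B).  Countably many rational boxes suffice for the pairs A, B. *)

(** * The Euclidean pairing, and the sup norm against the Euclidean norm *)

Section Dot.
Context {R : realType} {d : nat}.
Implicit Types x y z : 'cV[R]_d.

Lemma dotC x y : dot x y = dot y x.
Proof. by apply: eq_bigr => i _; rewrite mulrC. Qed.

Definition dotr y x : R^o := dot x y.

Lemma dotr_is_linear y : linear (dotr y).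
Proof.
move=> a x z; rewrite /dotr /dot scaler_sumr -big_split /=.
by apply: eq_bigr => i _; rewrite !mxE mulrDl -mulrA.
Qed.

HB.instance Definition _ y :=
  GRing.isLinear.Build R 'cV[R]_d R^o _ (dotr y) (dotr_is_linear y).

Lemma dotDl x z y : dot (x + z) y = dot x y + dot z y.
Proof. exact: (linearD (dotr y)). Qed.

Lemma dotBl x z y : dot (x - z) y = dot x y - dot z y.
Proof. exact: (linearB (dotr y)). Qed.

Lemma dotZl a x y : dot (a *: x) y = a * dot x y.
Proof. exact: (linearZ_LR (dotr y)). Qed.

Lemma dotBr x y z : dot x (y - z) = dot x y - dot x z.
Proof. by rewrite dotC dotBl !(dotC x). Qed.

Lemma dot_delta (j : 'I_d) y : dot (delta_mx j 0) y = y j 0.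
Proof.
rewrite /dot (bigD1 j)//= mxE !eqxx mul1r big1 ?addr0// => i ij.
by rewrite mxE (negPf ij) mul0r.
Qed.

Lemma coord_le_norm x i : `|x i 0| <= `|x|.
Proof.
rewrite [leRHS]/Num.norm /= mx_normrE.
by apply/bigmax_geP; right => /=; exists (i, 0).
Qed.

Lemma norm_le_coord x (r : R) :
  0 <= r -> (forall i, `|x i 0| <= r) -> `|x| <= r.
Proof.
move=> r0 h; rewrite [leLHS]/Num.norm /= mx_normrE.
by apply/bigmax_leP; split => //= -[i k] _ /=; rewrite ord1.
Qed.

Lemma ler_norm_dot x y : `|dot x y| <= d%:R * `|x| * `|y|.
Proof.
rewrite (le_trans (ler_norm_sum _ _ _))//.
have -> : d%:R * `|x| * `|y| = \sum_(i < d) `|x| * `|y|.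
  by rewrite sumr_const card_ord -mulrA mulr_natl.
by apply: ler_sum => i _; rewrite normrM ler_pM ?coord_le_norm.
Qed.

Lemma norm_le_enorm x : `|x| <= enorm x.
Proof.
apply: norm_le_coord => [|i]; first exact: sqrtr_ge0.
rewrite -sqrtr_sqr ler_wsqrtr// /dot (bigD1 i)//= -expr2 lerDl.
by apply: sumr_ge0 => k _; rewrite -expr2 sqr_ge0.
Qed.

(** From [dot x x <= d |x|^2 <= d^2 |x|^2]. This turns sup-norm closeness into a bound on
    [ediam]. *)
Lemma enorm_le_norm x : enorm x <= d%:R * `|x|.
Proof.
have h0 : 0 <= d%:R * `|x| by rewrite mulr_ge0.
rewrite /enorm -(ger0_norm h0) -sqrtr_sqr ler_wsqrtr//.
have := ler_norm_dot x x; rewrite -mulrA -expr2 => /(le_trans (ler_norm _)) h.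
rewrite (le_trans h)// exprMn ler_wpM2r ?sqr_ge0// -natrX ler_nat.
by case: (d) => // k; rewrite expnS leq_pmulr// expn_gt0.
Qed.

Lemma dot_continuous y : continuous (dotr y).
Proof.
apply/linear_bounded_continuous/linear_boundedP.
near=> r => x /=; rewrite (le_trans (ler_norm_dot _ _))//.
rewrite mulrAC ler_wpM2r//; near: r; exact: nbhs_pinfty_ge.
Unshelve. all: by end_near. Qed.

Lemma differentiable_dot y x : differentiable (dotr y) x.
Proof. exact/linear_differentiable/dot_continuous. Qed.

Lemma derive_dot y x v : 'D_v (dotr y) x = dot v y.
Proof.
rewrite deriveE; last exact: differentiable_dot.
by rewrite diff_lin//; exact: dot_continuous.
Qed.

End Dot.

(** * First-order conditions at a minimum *)

Section Minimum.
Context {R : realType} {V : normedModType R}.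

(** Difference quotients with a positive step are nonnegative, and the two-sided limit may be taken
    from the right. *)
Lemma derive_min_ge0 (f : V -> R^o) (x v : V) : derivable f x v ->
  (forall y, f x <= f y) -> 0 <= 'D_v f x.
Proof.
move=> df fmin; rewrite /derive cvg_at_rightE//.
apply: limr_ge.
  apply: (cvgP ('D_v f x)); apply: cvg_trans df; apply: cvg_app => A [e e0 Ae].
  by exists e => // t te t0; apply: Ae => //; exact/lt0r_neq0.
near=> h; apply: mulr_ge0; last by rewrite subr_ge0; exact: fmin.
by rewrite invr_ge0 ltW//; near: h; exact: nbhs_right_gt.
Unshelve. all: by end_near. Qed.

(** The one-sided inequality holds for [v] and for [- v], and the differential is linear. *)
Lemma derive_min_eq0 (f : V -> R^o) (x v : V) : differentiable f x ->
  (forall y, f x <= f y) -> 'D_v f x = 0.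
Proof.
move=> df fmin; have dv u : derivable f x u by exact: diff_derivable.
apply/eqP; rewrite eq_le derive_min_ge0// andbT.
have := @derive_min_ge0 f x (- v) (dv _) fmin.
by rewrite !deriveE// linearN oppr_ge0.
Qed.

End Minimum.

Section Gradient.
Context {R : realType} {d : nat}.

(* Both functions minimized at x have zero derivative there; eliminating the
   derivative of w leaves that of h. *)
Lemma gradient_touching (j : 'I_d) (h w : 'cV[R]_d -> R^o) (x y1 y2 : 'cV[R]_d) :
    differentiable h x -> differentiable w x ->
    (forall z, w x + y1 j 0 * h x - dot x y1 <= w z + y1 j 0 * h z - dot z y1) ->
    (forall z, w x + y2 j 0 * h x - dot x y2 <= w z + y2 j 0 * h z - dot z y2) ->
    y2 j 0 < y1 j 0 ->
  gradient h x = ((y1 - y2) j 0)^-1 *: (y1 - y2).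
Proof.
move=> dh dw m1 m2 lt12.
have D0 (v y : 'cV[R]_d) : (forall z, w x + y j 0 * h x - dot x y <=
      w z + y j 0 * h z - dot z y) ->
    'D_v w x + y j 0 * 'D_v h x = dot v y.
  move=> m.
  pose f := w + y j 0 \*: h - dotr y.
  have dyh : differentiable (y j 0 \*: h) x.
    exact: differentiableZ.
  have df : differentiable f x.
    by apply: differentiableB; [exact: differentiableD|exact: differentiable_dot].
  have := @derive_min_eq0 _ _ f x v df m.
  rewrite /f deriveB; last 2 first.
  - by apply/diff_derivable/differentiableD.
  - by apply/diff_derivable/differentiable_dot.
  rewrite deriveD; [|exact/diff_derivable..].
  rewrite deriveZ; last exact/diff_derivable.
  by rewrite derive_dot => /subr0_eq.
apply/colP => i; rewrite !mxE.
have h1 := D0 (delta_mx i 0) y1 m1; have h2 := D0 (delta_mx i 0) y2 m2.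
rewrite !dot_delta in h1 h2.
have n0 : y1 j 0 - y2 j 0 != 0 by rewrite subr_eq0 gt_eqF.
by rewrite -h1 -h2; field.
Qed.

End Gradient.

(** * Functions with a bounded selection of subgradients *)

Definition subgradient {R : realType} {d} (f : 'cV[R]_d -> R)
    (p : 'cV[R]_d -> 'cV[R]_d) : Prop :=
  forall z z', dot (z' - z) (p z) <= f z' - f z.

Section Subgradient.
Context {R : realType} {d : nat} {f : 'cV[R]_d -> R} {p : 'cV[R]_d -> 'cV[R]_d}.
Context {M : R} (subf : subgradient f p) (normp : forall z, `|p z| <= M).

Lemma subgradient_lipschitz z z' : `|f z' - f z| <= d%:R * M * `|z' - z|.
Proof.
have le_f x y : f x - f y <= d%:R * M * `|x - y|.
  apply: (@le_trans _ _ `|dot (y - x) (p x)|).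
    have := subf x y; have := ler_norm (- dot (y - x) (p x)).
    by rewrite normrN; lra.
  rewrite (le_trans (ler_norm_dot _ _))// distrC mulrAC.
  by rewrite ler_wpM2r// ler_wpM2l.
rewrite ler_norml le_f andbT lerNl opprB.
by rewrite -(normrN (z' - z)) opprB.
Qed.

(** The inequalities at the intermediate point [w], weighted by [l] and [1 - l], add up to the claim
    because their linear terms cancel. *)
Lemma subgradient_convex (l : R) z z' : 0 <= l <= 1 ->
  f (l *: z + (1 - l) *: z') <= l * f z + (1 - l) * f z'.
Proof.
move=> /andP[l0 l1]; set w := _ + _.
have h1 := subf w z; have h2 := subf w z'.
have : l * dot (z - w) (p w) + (1 - l) * dot (z' - w) (p w) = 0.
  rewrite -!dotZl -dotDl (_ : _ + _ = 0).
    by rewrite -(subrr 0) dotBl subrr.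
  by rewrite /w; apply/colP => i; rewrite !mxE; ring.
nra.
Qed.

End Subgradient.

(** * Splitting off the j-th coordinate *)

Section InsertCoordinate.
Context {R : realType} {d : nat} (j : 'I_d).

(** A linear right inverse of [row' j]; [unlift j i] is [None] exactly when [i = j]. *)
Definition insert0 (u : 'cV[R]_d.-1) : 'cV[R]_d :=
  \col_i oapp (fun k => u k 0) 0 (unlift j i).

Lemma insert0_row' z : z = insert0 (row' j z) + z j 0 *: delta_mx j 0.
Proof.
apply/colP => i; rewrite !mxE eqxx andbT.
case: unliftP => [k ->|->] /=; last by rewrite eqxx mulr1 add0r.
by rewrite mxE eq_sym (negPf (neq_lift j k)) mulr0 addr0.
Qed.

Lemma insert0_comb (l l' : R) u v :
  insert0 (l *: u + l' *: v) = l *: insert0 u + l' *: insert0 v.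
Proof.
apply/colP => i; rewrite !mxE.
by case: unliftP => [k _|_] /=; rewrite ?mxE// !mulr0 addr0.
Qed.

Lemma norm_insert0 u : `|insert0 u| <= `|u|.
Proof.
apply: norm_le_coord => // i; rewrite mxE.
by case: unliftP => [k _|_] /=; rewrite ?normr0// coord_le_norm.
Qed.

Lemma row'_continuous : continuous (row' j : 'cV[R]_d -> 'cV[R]_d.-1).
Proof.
apply/linear_bounded_continuous/linear_boundedP.
near=> r => x; apply: (@le_trans _ _ (1 * `|x|)).
  by rewrite mul1r; apply: norm_le_coord => // i; rewrite mxE coord_le_norm.
by rewrite ler_wpM2r//; near: r; exact: nbhs_pinfty_ge.
Unshelve. all: by end_near. Qed.

Lemma differentiable_row' x : differentiable (row' j : 'cV[R]_d -> 'cV[R]_d.-1) x.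
Proof. exact/linear_differentiable/row'_continuous. Qed.

End InsertCoordinate.

(** * The set where two convex functions agree, as a graph over the other coordinates *)

Section ImplicitFunction.
Context {R : realType} {d : nat} (j : 'I_d).
Context (f1 f2 : 'cV[R]_d -> R) (p1 p2 : 'cV[R]_d -> 'cV[R]_d) (M a b : R).
Context (sub1 : subgradient f1 p1) (sub2 : subgradient f2 p2).
Context (norm1 : forall z, `|p1 z| <= M) (norm2 : forall z, `|p2 z| <= M).
Context (ab : a < b).
Context (geb : forall z, b <= p1 z j 0) (lea : forall z, p2 z j 0 <= a).

Local Notation e := (delta_mx j 0 : 'cV[R]_d).

Let incr1 z (s s' : R) : s <= s' ->
  b * (s' - s) <= f1 (z + s' *: e) - f1 (z + s *: e).
Proof.
move=> ss'; apply: le_trans (sub1 _ _).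
rewrite opprD addrACA subrr add0r -scalerBl dotZl dot_delta mulrC.
by rewrite ler_wpM2l ?subr_ge0.
Qed.

(** The subgradient at the right endpoint bounds an increment from above, as the one at the left
    endpoint bounds it from below. *)
Let incr2 z (s s' : R) : s <= s' ->
  f2 (z + s' *: e) - f2 (z + s *: e) <= a * (s' - s).
Proof.
move=> ss'; rewrite -lerN2 opprB.
apply: le_trans (sub2 _ _).
rewrite opprD addrACA subrr add0r -scalerBl dotZl dot_delta.
rewrite -(opprB s' s) mulNr lerN2 mulrC ler_wpM2r ?subr_ge0//.
Qed.

Let line_continuous z :
  continuous (fun s : R => f1 (z + s *: e) - f2 (z + s *: e) : R).
Proof.
move=> s; apply/cvgrPdist_le => r r0.
have cM : 0 <= d%:R * M by rewrite mulr_ge0// (le_trans (normr_ge0 _) (norm1 z)).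
near=> t.
have bound f p : subgradient f p -> (forall z, `|p z| <= M) ->
    `|f (z + s *: e) - f (z + t *: e)| <= d%:R * M * `|s - t|.
  move=> subf normp; rewrite (le_trans (subgradient_lipschitz subf normp _ _))//.
  rewrite opprD addrACA subrr add0r -scalerBl normrZ ler_wpM2l//.
  rewrite ler_piMr//; apply: norm_le_coord => // i.
  by rewrite mxE eqxx andbT; case: eqP; rewrite ?normr0 ?normr1.
rewrite opprD addrACA -opprD (le_trans (ler_normB _ _))//.
rewrite (le_trans (lerD (bound _ _ sub1 norm1) (bound _ _ sub2 norm2)))//.
(* Each of the two Lipschitz bounds takes at most half of [r]; adding 1 keeps the denominator
   positive even if [M = 0]. *)
have : `|s - t| <= r / (2 * (d%:R * M + 1)).
  near: t; apply: (@cvgr_dist_le _ R^o); first exact: cvg_id.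
  by rewrite divr_gt0// mulr_gt0// ltr_wpDl.
rewrite ler_pdivlMr; last by rewrite mulr_gt0// ltr_wpDl.
by have := normr_ge0 (s - t); nra.
Unshelve. all: by end_near. Qed.

(** The difference [phi] rises at rate at least [b - a], so it is nonnegative at [|phi 0| / (b - a)]
    and nonpositive at the opposite point. *)
Let exists_level z : exists s, f1 (z + s *: e) = f2 (z + s *: e).
Proof.
pose phi s := f1 (z + s *: e) - f2 (z + s *: e).
have incr s s' : s <= s' -> (b - a) * (s' - s) <= phi s' - phi s.
  by move=> ss'; have := incr1 z _ _ ss'; have := incr2 z _ _ ss'; rewrite /phi; lra.
have ba0 : 0 < b - a by rewrite subr_gt0.
pose r := `|phi 0| / (b - a).
have r0 : 0 <= r by rewrite divr_ge0// ltW.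
have rE : (b - a) * r = `|phi 0| by rewrite /r mulrC divfK// gt_eqF.
have h1 : 0 <= phi r.
  by have := incr 0 r r0; have := ler_norm (- phi 0); rewrite normrN; lra.
have h2 : phi (- r) <= 0.
  have := incr (- r) 0; rewrite oppr_le0 => /(_ r0).
  by have := ler_norm (phi 0); lra.
have [| | |s _ phis] := @IVT R phi (- r) r 0.
- by lra.
- exact/continuous_subspaceT/line_continuous.
- by rewrite ge_min h2 le_max h1 orbT.
by exists s; apply/eqP; rewrite -subr_eq0; exact/eqP.
Qed.

Let unique_level z s s' : f1 (z + s *: e) = f2 (z + s *: e) ->
  f1 (z + s' *: e) = f2 (z + s' *: e) -> s = s'.
Proof.
wlog ss' : s s' / s <= s' => [wlg h h'|h h'].
  by case/orP: (le_total s s') => ss'; [|apply/esym]; exact: wlg.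
have := incr1 z _ _ ss'; have := incr2 z _ _ ss'; rewrite h h' => h2 h1.
have : (b - a) * (s' - s) <= 0 by lra.
by rewrite pmulr_rle0 ?subr_gt0// subr_le0 => s's; apply: le_anti; rewrite ss'.
Qed.

Lemma exists_Hclass_level (C : set 'cV[R]_d) :
    (forall z, C (((p1 z - p2 z) j 0)^-1 *: (p1 z - p2 z))) ->
  exists h, Hclass j C h /\ forall z, f1 z = f2 z -> h z = 0.
Proof.
move=> hC; have ba0 : 0 < b - a by rewrite subr_gt0.
have [T TE] := choice (fun u => exists_level (insert0 j u)).
pose pt u := insert0 j u + T u *: e.
pose v c u := f1 (pt u) - c * T u.
(* To the right of [T u], [f1 - c t] is nondecreasing; to the left, [f2 - c t] is nonincreasing.
   Hence the maximum is least at [t = T u], where both agree. *)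
have v_le c u t : a <= c <= b ->
    v c u <= Num.max (f1 (insert0 j u + t *: e)) (f2 (insert0 j u + t *: e)) - c * t.
  move=> /andP[ac cb]; rewrite lerBrDr le_max; apply/orP.
  have [tT|/ltW tT] := leP (T u) t; [left|right].
    by have := incr1 (insert0 j u) _ _ tT; rewrite /v /pt; nra.
  by have := incr2 (insert0 j u) _ _ tT; rewrite /v /pt TE; nra.
(* The competing height is the same convex combination of [T u] and [T u']; joint convexity of [f1]
   and [f2] does the rest. *)
have v_convex c u u' l : a <= c <= b -> 0 <= l <= 1 ->
    v c (l *: u + (1 - l) *: u') <= l * v c u + (1 - l) * v c u'.
  move=> cab l01; apply: le_trans (v_le c _ (l * T u + (1 - l) * T u') cab) _.
  have -> : insert0 j (l *: u + (1 - l) *: u') + (l * T u + (1 - l) * T u') *: e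
      = l *: pt u + (1 - l) *: pt u'.
    by rewrite insert0_comb /pt; apply/colP => i; rewrite !mxE; ring.
  have := subgradient_convex sub1 l (pt u) (pt u') l01.
  have := subgradient_convex sub2 l (pt u) (pt u') l01.
  rewrite -!TE -/(pt u) -/(pt u') /v => h2 h1.
  rewrite lerBlDr ge_max; apply/andP; split.
    by apply: le_trans h1 _; lra.
  by apply: le_trans h2 _; lra.
(* Testing the height [T u'] above [u] makes the displacement horizontal, so only the Lipschitz
   constants of [f1] and [f2] enter. *)
have v_lip c u u' : a <= c <= b -> v c u - v c u' <= d%:R * M * `|u - u'|.
  move=> cab; rewrite lerBlDr (le_trans (v_le c u (T u') cab))//.
  have cM : 0 <= d%:R * M by rewrite mulr_ge0// (le_trans (normr_ge0 _) (norm1 0)).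
  have bound f p : subgradient f p -> (forall z, `|p z| <= M) ->
      f (insert0 j u + T u' *: e) - f (pt u') <= d%:R * M * `|u - u'|.
    move=> subf normp; rewrite (le_trans (ler_norm _))//.
    rewrite (le_trans (subgradient_lipschitz subf normp _ _))//.
    rewrite ler_wpM2l// /pt opprD addrACA subrr addr0.
    have -> : insert0 j u - insert0 j u' = insert0 j (u - u').
      by have := insert0_comb j 1 (-1) u u'; rewrite !scale1r !scaleN1r => ->.
    exact: norm_insert0.
  have := bound _ _ sub1 norm1; have := bound _ _ sub2 norm2.
  rewrite /v -TE -/(pt u') => h2 h1.
  by rewrite lerBlDr ge_max; apply/andP; split; lra.
have iba0 : 0 <= (b - a)^-1 by rewrite invr_ge0 ltW.
have g_convex c : a <= c <= b -> convex_function setT (fun u => (b - a)^-1 * v c u).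
  move=> cab t u u' _ _; rewrite convRE.
  have t01 : 0 <= (t%:num : R) <= 1 by rewrite ge0 le1.
  rewrite !mulrA ![_ * (b - a)^-1]mulrC -!mulrA -mulrDr ler_wpM2l//.
  exact: (v_convex c u u' t%:num cab t01).
have g_growth c : a <= c <= b -> linear_growth (fun u => (b - a)^-1 * v c u).
  move=> cab; have dM : 0 <= d%:R * M.
    by rewrite mulr_ge0// (le_trans (normr_ge0 _) (norm1 0)).
  exists ((b - a)^-1 * (`|v c 0| + d%:R * M + 1)); split.
    by rewrite mulr_gt0 ?invr_gt0// ltr_wpDl// addr_ge0.
  move=> u; rewrite normrM ger0_norm// -mulrA.
  rewrite ler_wpM2l//.
  have := v_lip c u 0 cab; have := v_lip c 0 u cab.
  rewrite sub0r normrN subr0 => h1 h2.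
  have := norm_le_enorm u => nu.
  have : d%:R * M * `|u| <= d%:R * M * enorm u by rewrite ler_wpM2l.
  have := ler_norm (v c 0); have := ler_norm (- v c 0); rewrite normrN.
  have := normr_ge0 u; have := normr_ge0 (v c 0).
  by rewrite ler_norml => *; apply/andP; split; nra.
have aab : a <= a <= b by rewrite lexx ltW.
have abb : a <= b <= b by rewrite lexx ltW.
pose g c u := (b - a)^-1 * v c u.
(* Since [v b - v a = - (b - a) T], the difference [g b - g a] is [- T]. *)
pose h (x : 'cV[R]_d) : R^o := x j 0 + g b (row' j x) - g a (row' j x).
have hE x : h x = x j 0 - T (row' j x).
  rewrite /h /g /v -addrA -mulrBr; congr (_ + _); field.
  by rewrite gt_eqF.
exists h; split; last first.
  move=> z; rewrite hE {1 2}(insert0_row' j z) => f12.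
  by rewrite (unique_level _ _ _ f12 (TE _)) subrr.
exists (g b), (g a); split => [|||x dgb dga].
- by split; exact: g_convex.
- by split; exact: g_growth.
- by [].
have dcomp c : differentiable (g c : _ -> R^o) (row' j x) ->
    differentiable (fun z => g c (row' j z) : R^o) x.
  move=> dg; apply: (@differentiable_comp _ _ _ _ (row' j) (g c)) => //.
  exact: differentiable_row'.
have dj : differentiable (fun z : 'cV[R]_d => z j 0 : R^o) x.
  exact: differentiable_coord.
have dh : differentiable h x.
  apply: differentiableB; last exact: dcomp.
  by apply: differentiableD => //; exact: dcomp.
(* z - h(z) e is the point of the level set {f1 = f2} above row' j z. *)
pose w (z : 'cV[R]_d) : R^o := f1 (z - h z *: e).
have wE z : z - h z *: e = pt (row' j z).
  rewrite {1}(insert0_row' j z) hE /pt -addrA -scalerBl; congr (_ + _ *: _).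
  by rewrite opprB addrC subrK.
have dw : differentiable w x.
  (* On the graph [f1 = v a + a T], and [T] is recovered from [h]; differentiability of [w] thus
     comes from [g a] and [h]. *)
  rewrite (_ : w = (fun z => (b - a) * g a (row' j z) + a * (z j 0 - h z))); last first.
    apply/funext => z; rewrite /w wE hE /g /v; field.
    by rewrite gt_eqF.
  by apply: differentiableD; apply: differentiableZ;
    [exact: dcomp | exact: differentiableB].
(* This is the subgradient inequality between the graph points above [x] and [z]. As [f1 = f2]
   there, it applies to [p1] and [p2] alike and gives both minimality conditions of
   [gradient_touching]. *)
have touch f p : subgradient f p -> (forall u, f (pt u) = f1 (pt u)) -> forall z,
    w x + p (pt (row' j x)) j 0 * h x - dot x (p (pt (row' j x))) <=
    w z + p (pt (row' j x)) j 0 * h z - dot z (p (pt (row' j x))).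
  move=> subf fE z; have := subf (pt (row' j x)) (pt (row' j z)).
  by rewrite !fE /w -!wE !dotBl !dotZl dot_delta; lra.
rewrite (@gradient_touching _ _ j h w x (p1 (pt (row' j x))) (p2 (pt (row' j x))))//.
- exact: touch.
- by apply: touch => // u; rewrite /pt TE.
- exact: le_lt_trans (lea _) (lt_le_trans ab (geb _)).
Qed.

End ImplicitFunction.

(** * The quadratic form and the support functions of compact pieces *)

Section QuadraticForm.
Context {R : realType} {d : nat} (S : 'M[R]_d).

Lemma bform_diag_continuous : continuous (fun z => bform S z z : R^o).
Proof.
have cS i : continuous (fun z : 'cV[R]_d => (S *m z) i 0 : R^o).
  rewrite (_ : (fun z : 'cV[R]_d => _) = dotr (\col_k S i k)).
    exact: dot_continuous.
  apply/funext => z; rewrite /dotr /dot mxE.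
  by apply: eq_bigr => k _; rewrite mxE mulrC.
have coordM i : continuous (fun z : 'cV[R]_d => z i 0 * (S *m z) i 0 : R^o).
  by move=> z; apply: (cvgM (@coord_continuous R d 1 i 0 z) (cS i z)).
exact: (@continuous_big R^o 'I_d +%R 0 xpredT (@add_continuous R^o) _ _ _
  (fun i _ => coordM i)).
Qed.

Lemma bformN z : bform S (- z) (- z) = bform S z z.
Proof.
rewrite /bform mulmxN -[- z]scaleN1r -[- (S *m z)]scaleN1r.
by rewrite dotZl dotC dotZl dotC !mulN1r opprK.
Qed.

Context (symS : S^T = S).

Lemma dot_sym x y : dot x (S *m y) = dot (S *m x) y.
Proof.
have E (u v : 'cV[R]_d) : dot u v = (u^T *m v) 0 0.
  by rewrite mxE; apply: eq_bigr => i _; rewrite mxE.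
by rewrite !E trmx_mul symS mulmxA.
Qed.

(** Minimizing [bform S (x - y) (x - y)] over [y] is thus maximizing an affine function of [S *m x]:
    projections of [x] become maximizers at [S *m x]. *)
Lemma bform_sub x y : bform S (x - y) (x - y) =
  bform S x x - 2 * (dot (S *m x) y - 2^-1 * bform S y y).
Proof.
rewrite /bform mulmxBr !dotBr !dotBl (dot_sym x y) (dotC y (S *m x)).
by field.
Qed.

End QuadraticForm.

(** A maximizer [p z] exists by compactness; it still competes at [z'], which is the subgradient
    inequality. *)
Lemma exists_support_function {R : realType} {d} (A : set 'cV[R]_d)
    (c : 'cV[R]_d -> R^o) : A !=set0 -> compact A -> continuous c ->
  exists (f : 'cV[R]_d -> R) (p : 'cV[R]_d -> 'cV[R]_d),
    [/\ subgradient f p, forall z, A (p z),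
        forall z, f z = dot z (p z) - c (p z) &
        forall z y, A y -> dot z y - c y <= f z].
Proof.
move=> A0 cA cc.
have /choice[p pP] z : exists p, A p /\ forall y, A y ->
    dot z y - c y <= dot z p - c p.
  have cont : continuous (fun y => dot z y - c y : R^o).
    have cz : continuous (dot z : _ -> R^o).
      rewrite (_ : (dot z : _ -> R^o) = dotr z); first exact: dot_continuous.
      by apply/funext => x; exact: dotC.
    by move=> y; apply: (cvgB (cz y) (cc y)).
  have [q /set_mem Aq qmax] :=
    compact_EVT_max A0 cA (continuous_subspaceT cont).
  by exists q; split => // y Ay; apply: qmax; exact/mem_set.
exists (fun z => dot z (p z) - c (p z)), p; split => //.
- move=> z z'; have := (pP z').2 _ (pP z).1.
  by rewrite dotBl; lra.
- by move=> z; exact: (pP z).1.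
- by move=> z y; exact: (pP z).2.
Qed.

Lemma compact_setB {R : realType} {V : normedModType R} (A B : set V) :
  compact A -> compact B -> compact [set a - b | a in A & b in B].
Proof.
move=> cA cB.
have -> : [set a - b | a in A & b in B] =
    (fun x : V * V => x.1 - x.2) @` (A `*` B).
  apply/seteqP; split => [_ [a Aa [b Bb <-]]|_ [[a b] [/= Aa Bb] <-]].
    by exists (a, b).
  by exists a => //; exists b.
apply: continuous_compact; last exact: compact_setX.
by apply: continuous_subspaceT => x; apply: cvgB; [exact: cvg_fst|exact: cvg_snd].
Qed.

(** Projections in [A] and in [B] both attain the maximum over the union, so the two support
    functions agree at [S *m x]. *)
Lemma exists_Hclass_equidistant {R : realType} {d} (S : 'M[R]_d) (j : 'I_d)
    (A B : set 'cV[R]_d) (a b : R) : S^T = S ->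
    A !=set0 -> B !=set0 -> compact A -> compact B -> a < b ->
    (forall y, A y -> b <= y j 0) -> (forall y, B y -> y j 0 <= a) ->
  exists h, Hclass j (theta j [set x - y | x in A & y in B]) h /\
    forall x y1 y2, A y1 -> B y2 ->
      Sproj S (A `|` B) x y1 -> Sproj S (A `|` B) x y2 -> h (S *m x) = 0.
Proof.
move=> symS A0 B0 cA cB ab geb lea.
pose c y : R^o := 2^-1 * bform S y y.
have cc : continuous c.
  by move=> y; apply: (cvgMl_tmp (bform_diag_continuous S y)).
have [f1 [p1 [sub1 Ap1 f1E f1max]]] := exists_support_function A c A0 cA cc.
have [f2 [p2 [sub2 Bp2 f2E f2max]]] := exists_support_function B c B0 cB cc.
have [M1 [_ M1P]] := compact_bounded cA.
have [M2 [_ M2P]] := compact_bounded cB.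
(* Boundedness only provides bounds strictly larger than [M1] and [M2], hence the added 1. *)
pose M := Num.max M1 M2 + 1.
have n1 z : `|p1 z| <= M.
  by apply: M1P => //; rewrite /M ltr_pwDr// le_max lexx.
have n2 z : `|p2 z| <= M.
  by apply: M2P => //; rewrite /M ltr_pwDr// le_max lexx orbT.
(* As [p1] takes values in [A] and [p2] in [B], their normalized difference lies in
   [theta j (A - B)]. *)
have [h [hH h0]] := exists_Hclass_level j f1 f2 p1 p2 M a b sub1 sub2 n1 n2 ab
  (fun z => geb _ (Ap1 z)) (fun z => lea _ (Bp2 z))
  (theta j [set x - y | x in A & y in B])
  (fun z => ex_intro2 _ _ _
     (ex_intro2 _ _ _ (Ap1 z) (ex_intro2 _ _ _ (Bp2 z) erefl)) erefl).
exists h; split => // x y1 y2 Ay1 By2 [_ m1] [_ m2]; apply: h0.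
have {}m1 z : A z \/ B z -> dot (S *m x) z - c z <= dot (S *m x) y1 - c y1.
  by move=> /m1; rewrite !bform_sub// /c; lra.
have {}m2 z : A z \/ B z -> dot (S *m x) z - c z <= dot (S *m x) y2 - c y2.
  by move=> /m2; rewrite !bform_sub// /c; lra.
have := m1 _ (or_introl (Ap1 (S *m x))); have := m2 _ (or_intror (Bp2 (S *m x))).
have := m1 _ (or_intror By2); have := m2 _ (or_introl Ay1).
have := f1max (S *m x) _ Ay1; have := f2max (S *m x) _ By2.
by rewrite -f1E -f2E; lra.
Qed.

(** * Compactness for column vectors *)

Lemma norm_trmx {R : realType} {m n} (x : 'M[R]_(m, n)) : `|x^T| <= `|x|.
Proof.
rewrite [leLHS]/Num.norm /= mx_normrE; apply/bigmax_leP; split => //= -[i k] _ /=.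
rewrite mxE [leRHS]/Num.norm /= mx_normrE.
by apply/bigmax_geP; right => /=; exists (k, i).
Qed.

Lemma trmx_continuous {R : realType} {m n} :
  continuous (fun x : 'M[R]_(m, n) => x^T).
Proof.
apply/linear_bounded_continuous/linear_boundedP; near=> r => x.
apply: (le_trans (norm_trmx x)); rewrite -[leLHS]mul1r ler_wpM2r; [by []..|].
by near: r; exact: nbhs_pinfty_ge.
Unshelve. all: by end_near. Qed.

(** Heine-Borel for row vectors, carried over by the continuous transposition. *)
Lemma closed_bounded_compact {R : realType} {d} (A : set 'cV[R]_d) :
  closed A -> bounded_set A -> compact A.
Proof.
move=> clA [M [Mr bA]].
rewrite (_ : A = (fun x : 'rV[R]_d => x^T) @` [set x | A x^T]); last first.
  apply/seteqP; split => [x Ax|_ [x Ax <-]//].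
  by exists x^T; rewrite /= trmxK.
apply: continuous_compact.
  exact/continuous_subspaceT/trmx_continuous.
apply: bounded_closed_compact.
  exists M; split => // r Mr' x /= Ax.
  by rewrite -[x]trmxK; apply: le_trans (norm_trmx _) _; exact: bA Ax.
by apply: (closed_comp (f := fun x : 'rV[R]_d => x^T)) => // x _; exact: trmx_continuous.
Qed.

(** * A countable family of admissible pairs *)

Section Cover.
Context {R : realType} {d : nat} (S : 'M[R]_d) (G : set 'cV[R]_d) (j : 'I_d).

(** [A - B] will be one of the sets [C_n]. The inclusion in [G] makes a projection onto [G] that
    lies in [A] or [B] a projection onto their union. *)
Definition admissible_pair (eps : R) (A B : set 'cV[R]_d) : Prop :=
  [/\ [/\ A !=set0, B !=set0, compact A & compact B], A `|` B `<=` G,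
      exists a b, [/\ a < b, forall y, A y -> b <= y j 0 &
                      forall y, B y -> y j 0 <= a],
      [set x - y | x in A & y in B] `<=` admissible S G j &
      (ediam (theta j [set (x - y)%R | x in A & y in B]) < eps%:E)%E].

(** The positivity conditions are open and [th] is continuous at [w]; differences of points of [A]
    and [B] stay within [2 r] of [w]. *)
Lemma admissible_pair_near (eps : R) (y1 y2 : 'cV[R]_d) : 0 < eps -> closed G ->
    G y1 -> G y2 -> 0 < (y1 - y2) j 0 -> 0 < bform S (y1 - y2) (y1 - y2) ->
  exists2 r, 0 < r & forall A B, A `<=` G -> B `<=` G -> closed A -> closed B ->
    A y1 -> B y2 ->
    (forall y, A y -> `|y - y1| <= r) -> (forall y, B y -> `|y - y2| <= r) ->
    admissible_pair eps A B.
Proof.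
move=> eps0 clG Gy1 Gy2; set w := y1 - y2 => wj0 Sw0.
pose th (z : 'cV[R]_d) := (z j 0)^-1 *: z.
(* Two values of [th] within [eta] of [th w] are at sup distance at most [2 eta], and
   [(d + 1) * 2 eta = eps / 2]. *)
pose eta := eps / (4 * (d%:R + 1)).
have d0 : 0 < d%:R + 1 :> R by rewrite ltr_wpDl.
have eta0 : 0 < eta by rewrite divr_gt0// mulr_gt0.
have cj : (fun z : 'cV[R]_d => z j 0 : R) z @[z --> w] --> w j 0.
  exact: (@coord_continuous R d 1 j 0 w).
have cth : th z @[z --> w] --> th w.
  by apply: cvgZ cvg_id; apply: cvgV cj; rewrite gt_eqF.
have : \forall z \near w, [/\ 0 < (z : 'cV[R]_d) j 0, 0 < bform S z z &
    `|th w - th z| <= eta].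
  near=> z; split; near: z.
  - exact: (cvgr_gt _ cj _ wj0).
  - exact: (cvgr_gt _ (bform_diag_continuous S w) _ Sw0).
  - by move/cvgr_dist_le: cth; exact.
move=> /nbhs_normP[delta /= delta0 deltaP].
(* The first bound gives [2 r < delta]; the second leaves a gap between [y2 j 0 + r] and
   [y1 j 0 - r]. *)
pose r := Num.min (delta / 4) (w j 0 / 4).
have r1 : r <= delta / 4 by rewrite ge_min lexx.
have r2 : r <= w j 0 / 4 by rewrite ge_min lexx orbT.
have r0 : 0 < r by rewrite lt_min !divr_gt0.
exists r => // A B AG BG clA clB Ay1 By2 Ar Br.
have near_w x y : A x -> B y ->
    [/\ 0 < (x - y) j 0, 0 < bform S (x - y) (x - y) & `|th w - th (x - y)| <= eta].
  move=> /Ar Ax /Br By; apply: deltaP; rewrite /= distrC.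
  have -> : x - y - w = (x - y1) - (y - y2).
    by rewrite /w; apply/colP => i; rewrite !mxE; ring.
  by rewrite (le_lt_trans (ler_normB _ _))//; lra.
have compact_ball (C : set 'cV[R]_d) (y : 'cV[R]_d) : closed C ->
    (forall z, C z -> `|z - y| <= r) -> compact C.
  move=> clC Cr; apply: closed_bounded_compact => //.
  exists (`|y| + r); split; first exact: num_real.
  move=> M yM z /Cr zr /=.
  rewrite -[z](subrK y) (le_trans (ler_normD _ _))//; lra.
split.
- split; [by exists y1|by exists y2|exact: compact_ball Ar|exact: compact_ball Br].
- by move=> y [/AG|/BG].
- exists (y2 j 0 + r), (y1 j 0 - r); split.
  + by move: r2 wj0; rewrite /w !mxE; lra.
  + move=> y /Ar; have := coord_le_norm (y - y1) j; rewrite !mxE => h /(le_trans h).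
    by rewrite ler_norml => /andP[+ _]; lra.
  + move=> y /Br; have := coord_le_norm (y - y2) j; rewrite !mxE => h /(le_trans h).
    by rewrite ler_norml => /andP[_ +]; lra.
- move=> _ [x Ax [y By <-]]; have [h1 h2 _] := near_w _ _ Ax By.
  by split => //; exists x; [exact: AG|exists y => //; exact: BG].
(* The supremum is bounded by [eps / 2] so that the final inequality is strict. *)
- apply: (@le_lt_trans _ _ (eps / 2)%:E); last by rewrite lte_fin; lra.
  apply: ge_ereal_sup => _ [_ [_ [x Ax [y By <-]] <-] [_ [_ [x' Ax' [y' By' <-]] <-] <-]].
  rewrite lee_fin -!/(th _) (le_trans (enorm_le_norm _))//.
  have [_ _ h] := near_w _ _ Ax By; have [_ _ h'] := near_w _ _ Ax' By'.
  have hh : `|th (x - y) - th (x' - y')| <= eta + eta.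
    rewrite -(subrK (th w) (th (x - y))) -addrA (le_trans (ler_normD _ _))//.
    by rewrite lerD// distrC.
  have etaE : (d%:R + 1) * (eta + eta) = eps / 2 by rewrite /eta; field; rewrite gt_eqF.
  rewrite -etaE ler_pM// lerDl//.
Unshelve. all: by end_near. Qed.

Lemma rat_point_near (y : 'cV[R]_d) (r : R) : 0 < r ->
  exists q : 'cV[rat]_d, `|y - map_mx ratr q| <= r.
Proof.
move=> r0.
have /choice[q qP] i : exists q : rat, `|y i 0 - ratr q| <= r.
  have [q] := @rat_in_itvoo R (y i 0 - r) (y i 0 + r) ltac:(lra).
  rewrite in_itv/= => /andP[q1 q2]; exists q.
  by rewrite ler_norml; apply/andP; split; lra.
exists (\col_i q i); apply: norm_le_coord => [|i]; first exact: ltW.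
by rewrite !mxE.
Qed.

(** The pieces are traces on [G] of balls with rational centres and radii [1 / (n + 1)], enumerated
    by [pickle]. *)
Lemma exists_admissible_cover (eps : R) : 0 < eps -> closed G ->
    admissible S G j !=set0 ->
  exists A B : nat -> set 'cV[R]_d, (forall n, admissible_pair eps (A n) (B n)) /\
    forall y1 y2, G y1 -> G y2 -> 0 < (y1 - y2) j 0 ->
      0 < bform S (y1 - y2) (y1 - y2) -> exists n, A n y1 /\ B n y2.
Proof.
move=> eps0 clG [_ [[x0 Gx0 [y0 Gy0 <-]] xyj Sxy]].
pose box (q : 'cV[rat]_d) (n : nat) : set 'cV[R]_d :=
  G `&` [set y | `|y - map_mx ratr q| <= n.+1%:R^-1].
have clbox q n : closed (box q n).
  apply: closedI => //.
  have c : continuous (fun y : 'cV[R]_d => `|y - map_mx ratr q|).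
    by move=> y; apply: (cvg_norm (cvgB cvg_id (cvg_cst _))).
  exact: (closed_comp (fun y _ => c y) (@closed_le R _)).
have good0 : admissible_pair eps [set x0] [set y0].
  have [r r0 rP] := admissible_pair_near _ _ _ eps0 clG Gx0 Gy0 xyj Sxy.
  apply: rP => //.
  - by move=> _ ->.
  - by move=> _ ->.
  - exact/accessible_closed_set1/hausdorff_accessible/norm_hausdorff.
  - exact/accessible_closed_set1/hausdorff_accessible/norm_hausdorff.
  - by move=> _ ->; rewrite subrr normr0 ltW.
  - by move=> _ ->; rewrite subrr normr0 ltW.
pose I : Type := 'cV[rat]_d * 'cV[rat]_d * nat.
pose pair (i : I) := (box i.1.1 i.2, box i.1.2 i.2).
(* Codes of no pair, or of a pair that is not admissible, receive the default singletons at [x0] and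
   [y0]. *)
have /choice[AB ABP] n : exists AB : set 'cV[R]_d * set 'cV[R]_d,
    admissible_pair eps AB.1 AB.2 /\ forall i : I, unpickle n = Some i ->
      admissible_pair eps (pair i).1 (pair i).2 -> AB = pair i.
  have [[i [ni gi]]|none] := pselect (exists i : I, unpickle n = Some i /\
      admissible_pair eps (pair i).1 (pair i).2).
    by exists (pair i); split => // k; rewrite ni => -[->].
  exists ([set x0], [set y0]); split => // i ni gi; exfalso; apply: none.
  by exists i.
exists (fun n => (AB n).1), (fun n => (AB n).2); split => [n|y1 y2 Gy1 Gy2 wj Sw].
  exact: (ABP n).1.
have [r r0 rP] := admissible_pair_near _ _ _ eps0 clG Gy1 Gy2 wj Sw.
(* Both [y] and any point of its box are within [1 / (n + 1)] of the centre, so half of [r] is the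
   right threshold. *)
have [n nr] : exists n : nat, n.+1%:R^-1 <= r / 2.
  exists (Num.truncn (r / 2)^-1).
  rewrite invf_ple ?posrE ?divr_gt0//.
  by apply/ltW; exact: truncnS_gt.
have n0 : 0 < n.+1%:R^-1 :> R by rewrite invr_gt0.
have [q1 q1P] := rat_point_near y1 _ n0; have [q2 q2P] := rat_point_near y2 _ n0.
have box_near y q z : `|y - map_mx ratr q| <= n.+1%:R^-1 -> box q n z -> `|z - y| <= r.
  move=> yq [_ /= zq]; rewrite -(subrK (map_mx ratr q) z) -addrA.
  rewrite (le_trans (ler_normD _ _))// (distrC _ y).
  by rewrite (le_trans (lerD zq yq))// [leRHS]splitr lerD.
pose i : I := (q1, q2, n).
have gi : admissible_pair eps (pair i).1 (pair i).2.
  apply: rP.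
  - by move=> y [].
  - by move=> y [].
  - exact: clbox.
  - exact: clbox.
  - by [].
  - by [].
  - by move=> y; exact: (box_near y1 q1 y q1P).
  - by move=> y; exact: (box_near y2 q2 y q2P).
have ABi : AB (pickle i) = pair i.
  by apply: (ABP (pickle i)).2 gi; rewrite pickleK.
by exists (pickle i); rewrite ABi.
Qed.

End Cover.

(* H^j_C is empty when C is empty (convex functions are differentiable almost
   everywhere), so C_n and h_n exist only if G - G contains some x with x^j > 0
   and S(x,x) > 0.  Otherwise the singular set is empty and the covering family
   is the empty one. *)
Theorem theorem4p6 (R : realType) (d m : nat) (S : 'M[R]_d)
    (G : set 'cV[R]_d) (j : 'I_d)
    (hm : (m <= d)%N) (hS : sym_index m S) (hG : monotone_class S G)
    (hD : interior (dom_psi S G) !=set0) :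
  (admissible S G j !=set0 ->
     (exists (C : nat -> set 'cV[R]_d) (h : nat -> 'cV[R]_d -> R),
        Sigma1_cover S G j C h) /\
     (forall eps : R, 0 < eps ->
        exists (C : nat -> set 'cV[R]_d) (h : nat -> 'cV[R]_d -> R),
          Sigma1_cover S G j C h /\
          forall n, (ediam (theta j (C n)) < eps%:E)%E)) /\
  (~ (admissible S G j !=set0) -> Sigma1 S G j = set0).
Proof.
have [symS _ _] := hS; have [clG _ _] := hG.
(* The two projections may be swapped, the form being even, so that [y1] has the larger j-th
   coordinate. *)
have ordered x : Sigma1 S G j x -> exists y1 y2, [/\ Sproj S G x y1,
    Sproj S G x y2, 0 < (y1 - y2) j 0 & 0 < bform S (y1 - y2) (y1 - y2)].
  move=> [y1 [y2 [P1 P2 y12 S12]]]; move: y12; rewrite neq_lt => /orP[lt|lt].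
    exists y2, y1; split => //; first by rewrite !mxE subr_gt0.
    by rewrite -bformN opprB.
  by exists y1, y2; split => //; rewrite !mxE subr_gt0.
split=> [adm|nadm]; last first.
  apply/seteqP; split => // x /ordered[y1 [y2 [[G1 _] [G2 _] pos S12]]].
  apply: nadm; exists (y1 - y2); split => //.
  by exists y1 => //; exists y2.
have main (eps : R) : 0 < eps ->
    exists (C : nat -> set 'cV[R]_d) (h : nat -> 'cV[R]_d -> R),
      Sigma1_cover S G j C h /\ forall n, (ediam (theta j (C n)) < eps%:E)%E.
  move=> eps0.
  have [A [B [good cover]]] := exists_admissible_cover S G j eps eps0 clG adm.
  have /choice[h hP] n : exists h,
      Hclass j (theta j [set x - y | x in A n & y in B n]) h /\
      forall x y1 y2, A n y1 -> B n y2 -> Sproj S (A n `|` B n) x y1 ->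
        Sproj S (A n `|` B n) x y2 -> h (S *m x) = 0.
    have [[A0 B0 cA cB] _ [a [b [ab geb lea]]] _ _] := good n.
    exact: (exists_Hclass_equidistant S j (A n) (B n) a b).
  exists (fun n => [set x - y | x in A n & y in B n]), h; split; last first.
    by move=> n; have [] := good n.
  split=> [n|x /ordered[y1 [y2 [[G1 m1] [G2 m2] pos S12]]]].
    have [[A0 B0 cA cB] _ _ adm_n _] := good n.
    by split => //; [exact: compact_setB|exact: (hP n).1].
  have [n [Ay1 By2]] := cover _ _ G1 G2 pos S12; exists n => //=.
  have [_ AB_G _ _ _] := good n.
  apply: ((hP n).2 _ _ _ Ay1 By2).
    by split; [left|move=> z /AB_G; exact: m1].
  by split; [right|move=> z /AB_G; exact: m2].
split; last exact: main.
by have [C [h [hC _]]] := main 1 ltr01; exists C, h.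
Qed.
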